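(* Let $p,q\geq 1$ be integers and let $\lambda_2$ be the second largest eigenvalue of the adjacency matrix of $\mathcal{R}(\mathrm{SPK}_{p+1,q})$. Then (a) $h(\mathcal{R}(\mathrm{SPK}_{p+1,q}))<\dfrac{2}{p}$, and (b) $\lambda_2>p+q-\dfrac{4}{p}$.
   Context: Graphs are finite, simple and undirected. $\mathrm{SPK}_{p,q}$ denotes the complete split graph whose vertex set is the disjoint union of a clique of size $p$ and an independent set of size $q$, with every vertex of the clique adjacent to every vertex of the independent set. A search tree $T$ on a connected graph $G$ is a rooted tree with vertex set $V(G)$, defined recursively: the root of $T$ is a chosen vertex $r\in V(G)$, and the children of $r$ are the roots of search trees on each of the connected components of $G-r$. Let $T$ be a search tree on $G$ and let $v$ be a child of $u$ in $T$. The $uv$-rotation transforms $T$ into the search tree $T'$ on $G$ such that: (i) $u$ is a child of $v$ in $T'$; if $u$ is the root of $T$ then $v$ is the root of $T'$, otherwise, if $p$ is the parent of $u$ in $T$, then $p$ is the parent of $v$ in $T'$; (ii) every subtree of $u$ in $T$ other than the one rooted at $v$ remains a subtree of $u$ in $T'$; (iii) each subtree $S$ of $v$ in $T$ becomes a subtree of $u$ in $T'$ if $u$ is adjacent in $G$ to some vertex of $S$, and otherwise remains a subtree of $v$. All other parent-child relations are unchanged. The rotation graph $\mathcal{R}(G)$ is the undirected graph whose vertices are the search trees on $G$, two search trees being adjacent if one is obtained from the other by a single rotation. It is $(|V(G)|-1)$-regular. The edge expansion of a graph $H$ is $h(H)=\min |\partial S|/|S|$ over nonempty $S\subseteq V(H)$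 with $|S|\leq |V(H)|/2$, where $\partial S$ is the set of edges with one endpoint in $S$ and the other in $V(H)\setminus S$. Eigenvalues $\lambda_1\geq\lambda_2\geq\dots$ are listed with multiplicity. *)

(* Defs.v *)
From HB Require Import structures.
From mathcomp Require Import all_boot all_order all_algebra.
From mathcomp Require Import boolp constructive_ereal.
From mathcomp Require Import polyrcf.

Set Implicit Arguments.
Unset Strict Implicit.
Unset Printing Implicit Defensive.

Import Order.TTheory GRing.Theory Num.Theory.

Record sgraph := SGraph {
  vertex :> finType;
  adj : rel vertex;
  adj_sym : symmetric adj;
  adj_irr : irreflexive adj }.

Section CompleteSplit.
Variables p q : nat.

(* [inl] is the clique side, [inr] the independent side. *)
Definition spk_adj (x y : 'I_p + 'I_q) : bool :=
  match x, y with
  | inl i, inl j => i != j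
  | inr _, inr _ => false
  | _, _ => true
  end.

Lemma spk_sym : symmetric spk_adj.
Proof. by case=> i [] j //=; rewrite eq_sym. Qed.

Lemma spk_irr : irreflexive spk_adj.
Proof. by case=> i //=; rewrite eqxx. Qed.

Definition SPK : sgraph := SGraph spk_sym spk_irr.

End CompleteSplit.

Section SearchTrees.
Variable G : sgraph.
Implicit Types (C D : {set G}) (u v w : G).

Definition induced_adj C : rel G :=
  [rel x y | [&& x \in C, y \in C & adj x y]].

Definition components C : {set {set G}} :=
  equivalence_partition (connect (induced_adj C)) C.

(* A rooted tree on the vertex set of G is encoded by its parent function:
   [T v] is the parent of [v], and [None] if [v] is the root. *)
Definition parent_fun := {ffun G -> option G}.

(* [search_tree_on T o C]: the restriction of [T] to the connected set [C] is
   a search tree on the subgraph induced by [C], whose root has parent [o]. *)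
Inductive search_tree_on (T : parent_fun) : option G -> {set G} -> Prop :=
  SearchTree (o : option G) C r :
    r \in C -> T r = o ->
    (forall D, D \in components (C :\ r) -> search_tree_on T (Some r) D) ->
    search_tree_on T o C.

Definition is_search_tree (T : parent_fun) : bool :=
  `[< search_tree_on T None [set: G] >].

(* Only meaningful when G is connected. *)
Definition search_tree := {T : parent_fun | is_search_tree T}.

(* Vertex set of the subtree of T rooted at [w]: all the descendants of [w]. *)
Definition subtree (T : parent_fun) w : {set G} :=
  [set x | connect [rel a b | T b == Some a] w x].

(* The uv-rotation, where [v] is a child of [u] in [T]. *)
Definition rotate u v (T : parent_fun) : parent_fun :=
  [ffun w => if w == v then T u
             else if w == u then Some v
             else if (T w == Some v) && [exists x in subtree T w, adj u x]
                  then Some u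
             else T w].

Definition rotates_to (T T' : search_tree) : bool :=
  [exists u, exists v,
     (val T v == Some u) && (val T' == rotate u v (val T))].

Definition rotation_adj (T T' : search_tree) : bool :=
  rotates_to T T' || rotates_to T' T.

Lemma rotation_sym : symmetric rotation_adj.
Proof. by move=> T T'; rewrite /rotation_adj orbC. Qed.

Lemma component_sub C D : D \in components C -> D \subset C.
Proof.
by case/imsetP=> x _ ->; apply/subsetP=> y; rewrite inE => /andP[].
Qed.

Lemma component_cover C x :
  x \in C -> exists2 D, D \in components C & x \in D.
Proof.
move=> xC; exists [set y in C | connect (induced_adj C) x y].
  by apply/imsetP; exists x.
by rewrite inE xC connect0.
Qed.

Lemma search_tree_parent_neq (T : parent_fun) o C :
    search_tree_on T o C -> (forall w, w \in C -> o != Some w) ->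
  forall x, x \in C -> T x != Some x.
Proof.
elim=> {C}o C r rC Tr _ IH oC x xC.
have [->|xr] := eqVneq x r; first by rewrite Tr oC.
have [|D DC xD] := @component_cover (C :\ r) x; first by rewrite !inE xr.
apply: (IH D DC _ x xD) => w wD; apply/eqP => -[rw].
by have /subsetP/(_ w wD) := component_sub DC; rewrite !inE rw eqxx.
Qed.

Lemma rotation_irr : irreflexive rotation_adj.
Proof.
move=> T; rewrite /rotation_adj orbb; apply/negbTE/negP.
case/existsP=> u /existsP[v /andP[/eqP Tv /eqP TE]].
have /asboolP tT := valP T.
have nT x : val T x != Some x by apply: (search_tree_parent_neq tT).
have := congr1 (fun f : parent_fun => f v) TE.
by rewrite /= ffunE eqxx Tv => /esym/eqP; apply/negP.
Qed.

Definition rotation_graph : sgraph := SGraph rotation_sym rotation_irr.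

End SearchTrees.

Local Open Scope ring_scope.

Section Spectrum.
Variable R : rcfType.

Definition adj_matrix (H : sgraph) : 'M[R]_#|H| :=
  \matrix_(i, j) (adj (enum_val i) (enum_val j))%:R.

(* The eigenvalues of A that lie in R, in nonincreasing order, each repeated
   according to its multiplicity. For a symmetric A these are all of them. *)
Definition eigenvalues n (A : 'M[R]_n) : seq R :=
  flatten [seq nseq (mup x (char_poly A)) x | x <- rev (rootsR (char_poly A))].

(* Positions in a sequence are counted from 0. *)
Definition lambda2 (H : sgraph) : R := nth 0 (eigenvalues (adj_matrix H)) 1.

End Spectrum.

Section Expansion.
Variable R : realFieldType.

(* An edge of the boundary is counted once, as the pair (x, y) with x its
   endpoint in S and y its endpoint outside S. *)
Definition boundary (H : sgraph) (S : {set H}) : {set H * H} :=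
  [set e | [&& e.1 \in S, e.2 \notin S & adj e.1 e.2]].

(* The minimum is taken in the extended reals, so that it is a total function
   of H, with value +oo when no S is admissible (i.e., #|H| <= 1). *)
Definition edge_expansion (H : sgraph) : \bar R :=
  \big[Order.min/+oo%E]_(S : {set H} | (S != set0) && (#|S|.*2 <= #|H|)%N)
     (#|boundary S|%:R / #|S|%:R)%:E.

End Expansion.

(* Main.v *)
Require Import Defs.
From mathcomp Require Import all_boot all_order all_algebra perm.
From mathcomp Require Import boolp constructive_ereal.
From mathcomp Require Import polyrcf complex spectral sesquilinear.
From mathcomp Require Import lra ring zify.

Set Implicit Arguments.
Unset Strict Implicit.
Unset Printing Implicit Defensive.
Import Order.TTheory GRing.Theory Num.Theory.

(** A search tree on the complete split graph with clique P and independent set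
    Q is a path followed by leaves: as long as a clique vertex remains, the
    remaining graph is connected, so every removed vertex has at most one child;
    once the clique is used up, the remaining vertices are isolated and become
    the children of the last clique vertex. Such a tree is therefore the same
    thing as a duplicate-free sequence of vertices, its chain, that contains all
    of P and ends in P ([is_search_treeP], [chain_tree_inj]). On chains a
    rotation exchanges two consecutive vertices, or moves a vertex of Q into or
    out of the place just before the last vertex ([rotate_chain_tree]).

    For the sparse cut, fix a clique vertex a and consider the rank of a, that
    is, its position among the clique vertices of the chain. Permuting the
    clique permutes the search trees, so each of the p+1 ranks is taken by the
    same number c of trees ([card_clique_rank]). Let S consist of the trees where
    the rank of a is at most k (counted from 0). A rotation that leaves S
    exchanges a, at rank k, with the clique vertex right after it; so a tree has
    at most one such rotation, and it has none if a vertex of Q stands right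
    after a. Hence S has (k+1)c elements and fewer than c boundary edges
    ([boundary_early_lt_rank]), and the choice of k+1 as half of p+1, rounded
    down, gives edge expansion less than 1/(k+1), which is at most 2/p.

    For the second eigenvalue, every search tree has at least p+q neighbours,
    because the p+q edges of the tree give pairwise different rotations
    ([rotation_degree]). On the plane spanned by the indicator functions of S and
    of its complement, the Rayleigh quotient of the adjacency matrix then exceeds
    p+q-4/p, and by the min-max principle so does the second eigenvalue
    ([second_eigenvalue_gt], [lambda2_gt_cut]). The min-max principle is derived
    from the unitary diagonalization of the matrix over the complex numbers. *)

Arguments adj : simpl never.

(** * Parent functions of chains *)

Lemma uniq_cat_cons_inj (V : eqType) (x : V) l l' t t' :
  uniq (l ++ x :: t) -> l ++ x :: t = l' ++ x :: t' -> l = l' /\ t = t'.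
Proof.
move=> U E; have U' := U; rewrite E in U'.
have idx (k s : seq V) : uniq (k ++ x :: s) -> index x (k ++ x :: s) = size k.
  rewrite cat_uniq /= negb_or => /and3P[_ /andP[/negPf xk _] _].
  by rewrite index_cat xk /= eqxx addn0.
have sz : size l == size l' by rewrite -(idx _ _ U) E idx.
by move/eqP: E; rewrite eqseq_cat ?(eqP sz) // => /andP[/eqP-> /eqP[->]].
Qed.

Section Chains.
Variable V : eqType.
Implicit Types (o : option V) (s l t : seq V) (u v w : V).

(** The parent of [v] in the tree made of the path [s], whose first vertex has
    parent [o], with all other vertices as children of the last vertex of [s].
    The index of a vertex outside [s] is the size of [s], so that the same
    formula serves for the leaves. *)
Definition chain_parent o s v : option V := nth None (o :: map Some s) (index v s).

Lemma chain_parent_head o s v : chain_parent o (v :: s) v = o.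
Proof. by rewrite /chain_parent /= eqxx. Qed.

Lemma chain_parent_cons o s u v :
  v != u -> chain_parent o (u :: s) v = chain_parent (Some u) s v.
Proof. by rewrite /chain_parent /= eq_sym => /negPf->. Qed.

Lemma chain_parent_cat o l t v :
  chain_parent o (l ++ t) v =
  if v \in l then chain_parent o l v else chain_parent (last o (map Some l)) t v.
Proof.
elim: l o => [|u l IH] o //=; rewrite in_cons.
have [->|vu] := eqVneq v u; first by rewrite !chain_parent_head.
by rewrite !chain_parent_cons // IH.
Qed.

Lemma chain_parent_mem o s u v :
  chain_parent o s v = Some u -> (u \in s) || (o == Some u).
Proof.
elim: s o => [|w s IH] o; first by rewrite /chain_parent /= => ->; rewrite eqxx.
have [->|vw] := eqVneq v w; first by rewrite chain_parent_head => ->; rewrite eqxx orbT.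
rewrite chain_parent_cons // => /IH; rewrite in_cons.
by case/orP=> [->|/eqP[<-]]; rewrite ?eqxx ?orbT.
Qed.

(** Along a chain, the index is the depth in the tree; this also holds for the
    leaves, whose index is the size of the chain. *)
Lemma chain_parent_index s u v :
  uniq s -> chain_parent None s v = Some u -> index v s = (index u s).+1.
Proof.
rewrite /chain_parent; case E: (index v s) => [|k] //= Us.
have ks : k < size s by rewrite -E index_size.
by rewrite (nth_map u) // => -[<-]; rewrite index_uniq.
Qed.

Lemma chain_parent_split s u v :
  uniq s -> chain_parent None s v = Some u ->
  (exists l r, s = l ++ u :: v :: r) \/ (exists2 l, s = l ++ [:: u] & v \notin s).
Proof.
move=> Us Tv; have := chain_parent_mem Tv; rewrite orbF => us.
have := chain_parent_index Us Tv.
case/splitPr: us Us Tv => l r Us Tv E.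
have ul : index u (l ++ u :: r) = size l.
  rewrite index_cat; move: Us; rewrite cat_uniq /= negb_or.
  by case/and3P=> _ /andP[/negPf-> _] _; rewrite eqxx addn0.
rewrite {}ul in E; case: r => [|w r] in Us Tv E *; [right|left].
  by exists l => //; rewrite -index_mem E size_cat addn1 ltnn.
have vs : v \in l ++ u :: w :: r by rewrite -index_mem E size_cat /= !addnS !ltnS leq_addr.
have := nth_index v vs; rewrite E nth_cat ltnNge leqnSn /= subSn // subnn /= => ->.
by exists l, r.
Qed.

(** The index of a vertex in the chain is its depth, which the parent function
    determines, by induction from the root. *)
Lemma chain_parent_inj s t :
  uniq s -> uniq t -> (forall v, chain_parent None s v = chain_parent None t v) ->
  forall v, index v s = index v t.
Proof.
move=> Us Ut E v; have [k] := ubnP (index v s); elim: k v => // k IH v lt_k.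
case Tv: (chain_parent None s v) => [u|].
  rewrite (chain_parent_index Us Tv) ltnS in lt_k *.
  by rewrite E in Tv; rewrite (chain_parent_index Ut Tv) IH.
suff none t' : chain_parent None t' v = None -> index v t' = 0.
  by rewrite (none s) ?(none t) // -E.
rewrite /chain_parent; case K: (index v t') => [|j] //=.
by rewrite (nth_map v) // -K index_size.
Qed.

Lemma chain_path o l w r : uniq (l ++ w :: r) ->
  path [rel a b | chain_parent o (l ++ w :: r) b == Some a] w r.
Proof.
elim: r l w => [|x r IH] l w U //=; apply/andP; split; last first.
  by have := IH (rcons l w) x; rewrite cat_rcons; apply.
rewrite chain_parent_cat; move: U; rewrite cat_uniq /= !negb_or.
case/and3P=> _ /and3P[_ /negPf-> _] /andP[/andP[wx _] _].
by rewrite chain_parent_cons 1?eq_sym // chain_parent_head.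
Qed.

End Chains.

(** * Search trees on complete split graphs are chains *)

Section SplitGraph.
Variables n q : nat.
Local Notation G := (SPK n q).
Implicit Types (C D : {set G}) (u v w r : G) (s l t : seq G) (T : parent_fun G).

Definition in_clique v : bool := if v is inl _ then true else false.

Lemma spk_adjE u v : adj u v = (u != v) && (in_clique u || in_clique v).
Proof. by case: u v => [i|i] [j|j] /=; rewrite ?andbT ?andbF. Qed.

Lemma induced_adjE C u v : induced_adj C u v =
  [&& u \in C, v \in C, u != v & in_clique u || in_clique v].
Proof. by rewrite -spk_adjE. Qed.

Lemma components_clique C x : x \in C -> in_clique x ->
  forall D, (D \in components C) = (D == C).
Proof.
move=> xC qx D.
have cx y z : y \in C -> z \in C -> connect (induced_adj C) y z.
  have c1 y' : y' \in C -> connect (induced_adj C) y' x /\ connect (induced_adj C) x y'.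
    move=> yC; have [->|yx] := eqVneq y' x; first by rewrite connect0.
    by split; apply: connect1; rewrite induced_adjE xC yC qx ?orbT ?yx // eq_sym yx.
  by move=> /c1[yx _] /c1[_]; apply: connect_trans.
have E y : y \in C -> [set z in C | connect (induced_adj C) y z] = C.
  by move=> yC; apply/setP=> z; rewrite inE andb_idr // => /(cx _ _ yC).
apply/imsetP/eqP => [[y yC ->]|->]; first exact: E.
by exists x => //; rewrite E.
Qed.

Lemma components_indep C : (forall x, x \in C -> ~~ in_clique x) ->
  components C = [set [set x] | x in C].
Proof.
move=> nC; apply: eq_in_imset => x xC; apply/setP=> y; rewrite !inE.
apply/andP/eqP => [[yC /connectP[[|z t] //]]|->]; last by rewrite xC connect0.
rewrite [path _ _ _]/= induced_adjE => /andP[/and4P[_ zC _]].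
by rewrite (negPf (nC _ xC)) (negPf (nC _ zC)).
Qed.

(* An empty chain has no last vertex and fails this test. *)
Definition ends_in_clique s : bool := oapp in_clique false (last None (map Some s)).

Definition search_chain C s :=
  [/\ uniq s, {subset s <= C}, {in C, forall x, in_clique x -> x \in s}
     & ends_in_clique s].

Lemma ends_in_clique_cons u s :
  ends_in_clique (u :: s) = if s is [::] then in_clique u else ends_in_clique s.
Proof. by case: s. Qed.

(** Taking the root off a chain: the recursion of search trees, read on chains.
    The chain stops exactly when the last clique vertex is removed. *)
Lemma search_chain_cons C r s : r \in C ->
  search_chain C (r :: s) <->
  if s is [::] then in_clique r /\ (forall x, x \in C :\ r -> ~~ in_clique x)
  else search_chain (C :\ r) s.
Proof.
rewrite /search_chain ends_in_clique_cons => rC; case: s => [|v s].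
  split=> [[_ _ cC qr]|[qr cC]].
    split=> // x; rewrite !inE => /andP[xr xC]; apply/negP => /(cC _ xC).
    by rewrite inE (negPf xr).
  split=> // x; first by rewrite inE => /eqP->.
  move=> xC qx; rewrite inE; apply: contraTT qx => xr.
  by apply: cC; rewrite !inE xr.
move: (v :: s) => {v}s; rewrite cons_uniq; split=> [[/andP[rs Us] sC cC qs]|[Us sC cC qs]].
  split=> // x xs.
    by rewrite !inE sC ?inE ?xs ?orbT // andbT; apply: contraNneq rs => <-.
  by move: xs; rewrite !inE => /andP[xr xC] /(cC x xC); rewrite inE (negPf xr).
split=> //; first by rewrite Us andbT; apply/negP => /sC; rewrite !inE eqxx.
  by move=> x; rewrite inE => /predU1P[->//|/sC]; rewrite inE => /andP[].
move=> x xC qx; rewrite inE; have [//|xr] := eqVneq x r.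
by apply: cC => //; rewrite !inE xr.
Qed.

Lemma search_tree_singleton T o v : search_tree_on T o [set v] -> T v = o.
Proof.
move E: [set v] => D tD; case: {o D} tD E => o D r rD Tr _ E.
by move: rD; rewrite -E inE => /eqP <-.
Qed.

(** Induction on the tree: if a clique vertex is left after the removal of the
    root, the rest is connected and its chain is extended by the root; otherwise
    the root is the last clique vertex and the rest consists of leaves. *)
Lemma search_tree_chain T o C : search_tree_on T o C ->
  (exists2 x, x \in C & in_clique x) ->
  exists2 s, search_chain C s & {in C, T =1 chain_parent o s}.
Proof.
elim=> {C}o C r rC Tr sub IH [x xC qx].
have [/existsP[y /andP[yC qy]]|] := boolP [exists y, (y \in C :\ r) && in_clique y].
  have compC : C :\ r \in components (C :\ r) by rewrite (components_clique yC).
  have [|s sP Ts] := IH _ compC; first by exists y.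
  exists (r :: s).
    apply/search_chain_cons => //; case: (s) sP => // -[_ _].
    by move/(_ y yC qy).
  move=> v vC; have [->|vr] := eqVneq v r; first by rewrite chain_parent_head.
  by rewrite chain_parent_cons // Ts // !inE vr.
rewrite negb_exists => /forallP nC.
have nC' y : y \in C :\ r -> ~~ in_clique y by move=> yC; have := nC y; rewrite yC.
exists [:: r].
  apply/search_chain_cons => //; split=> //; have [<-//|xr] := eqVneq x r.
  by have := nC' x; rewrite !inE xr xC qx => /(_ isT).
move=> v vC; have [->|vr] := eqVneq v r; first by rewrite chain_parent_head.
rewrite chain_parent_cons //.
have /sub : [set v] \in components (C :\ r).
  by rewrite components_indep //; apply: imset_f; rewrite !inE vr.
exact: search_tree_singleton.
Qed.

Lemma chain_search_tree T o C s : search_chain C s ->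
  {in C, T =1 chain_parent o s} -> search_tree_on T o C.
Proof.
elim: s o C => [|r s IH] o C sP Ts; first by case: sP.
have rC : r \in C by case: sP => _ /(_ r); rewrite inE eqxx => /(_ isT).
apply: (SearchTree rC); first by rewrite Ts // chain_parent_head.
have {}Ts : {in C :\ r, T =1 chain_parent (Some r) s}.
  by move=> v; rewrite !inE => /andP[vr vC]; rewrite Ts // chain_parent_cons.
move/(search_chain_cons _ rC): sP => sP D; case: s => [|v s] in IH sP Ts *.
  case: sP => _ nC; rewrite components_indep // => /imsetP[w wC ->].
  apply: (@SearchTree _ _ _ _ w); rewrite ?inE ?eqxx ?Ts // => E.
  by rewrite setDv /components /equivalence_partition imset0 inE.
have vs : v \in v :: s by rewrite inE eqxx.
have [x xC qx] : exists2 x, x \in C :\ r & in_clique x.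
  case: sP => _ sC _ qs; exists (last v s); first by rewrite sC // mem_last.
  by move: qs; rewrite /ends_in_clique /= last_map.
by rewrite (components_clique xC) // => /eqP->; apply: IH.
Qed.

End SplitGraph.

Section SearchTreesOfSplitGraph.
Variables p q : nat.
Local Notation G := (SPK p.+1 q).
Implicit Types (u v w x : G) (s l r : seq G).

(** The boolean form of [search_chain] on the full vertex set, so that a chain can
    be chosen for each tree. *)
Definition spanning_chain s : bool :=
  [&& uniq s, [forall i, inl i \in s] & ends_in_clique s].

Definition chain_tree s : parent_fun G := [ffun v => chain_parent None s v].

Lemma spanning_chainP s : reflect (search_chain [set: G] s) (spanning_chain s).
Proof.
apply: (iffP and3P) => [[Us /forallP clq qs]|[Us _ clq qs]]; split=> //.
- by move=> x _; apply: in_setT.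
- by case=> // i _ _; apply: clq.
by apply/forallP => i; exact: (clq _ (in_setT _)).
Qed.

Lemma is_search_treeP (T : parent_fun G) :
  reflect (exists s, spanning_chain s && (T == chain_tree s)) (is_search_tree T).
Proof.
apply: (iffP (asboolP _)) => [tT|[s /andP[/spanning_chainP sP /eqP->]]].
  have [|s /spanning_chainP sP Ts] := search_tree_chain tT.
    by exists (inl ord0); rewrite ?in_setT.
  by exists s; rewrite sP; apply/eqP/ffunP => v; rewrite ffunE Ts ?in_setT.
by apply: chain_search_tree sP _ => v _; rewrite ffunE.
Qed.

Lemma chain_tree_inj : {in spanning_chain &, injective chain_tree}.
Proof.
move=> s t sP tP /ffunP E.
have /and3P[Us _ _] := sP; have /and3P[Ut _ _] := tP.
have ist v : index v s = index v t.
  by apply: chain_parent_inj => // {}v; have := E v; rewrite !ffunE.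
(* The last vertex is a clique vertex, so it occurs in the other chain as well,
   at the same index; this compares the lengths. *)
have le_size s1 s2 : spanning_chain s1 -> spanning_chain s2 ->
    (forall v, index v s1 = index v s2) -> size s1 <= size s2.
  case: s1 => [//|v s1] /and3P[U1 _].
  rewrite /ends_in_clique [last _ _]last_map => q1 /and3P[_ /forallP clq2 _] i12.
  rewrite [size _]/= -(index_last U1) i12 index_mem.
  by case: (last v s1) q1 => // i _; apply: clq2.
have [->//|neq] := eqVneq s t.
have st : size s = size t by apply/eqP; rewrite eqn_leq !le_size.
case/eqP: neq => {E}; case: s => [|v s] in Us sP ist st *; first by case/and3P: sP.
apply: (@eq_from_nth _ v) => // i lt_i.
have := ist (nth v (v :: s) i); rewrite (index_uniq _ lt_i) // => E.
by rewrite {2}E nth_index // -index_mem -E -st.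
Qed.

(** * Rotations on chains *)

Definition clique_vertex v : option 'I_p.+1 := if v is inl i then Some i else None.

Definition clique_order s : seq 'I_p.+1 := pmap clique_vertex s.

Lemma subtree_last_chain l w r : uniq (l ++ w :: r) ->
  last w r \in subtree (chain_tree (l ++ w :: r)) w.
Proof.
move=> U; rewrite inE; apply/connectP; exists r => //.
by rewrite (eq_path (e' := [rel a b | chain_parent None (l ++ w :: r) b == Some a]))
  ?chain_path // => a b /=; rewrite ffunE.
Qed.

Lemma subtree_leaf s w : w \notin s -> subtree (chain_tree s) w = [set w].
Proof.
move=> ws; apply/setP=> x; rewrite !inE; apply/idP/eqP => [|->//].
case/connectP=> [[|y t] //= /andP[]]; rewrite ffunE => /eqP /chain_parent_mem.
by rewrite (negPf ws).
Qed.

(** Either [v] has a single child, whose subtree contains the last vertex of the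
    chain, a clique vertex, or [v] is the last vertex and its children are leaves
    adjacent to the clique vertex [u]. In both cases every subtree of [v] has a
    vertex adjacent to [u] and passes to [u]. *)
Lemma rotate_swap l u v r :
  spanning_chain (l ++ u :: v :: r) -> (r != [::]) || in_clique u ->
  rotate u v (chain_tree (l ++ u :: v :: r)) = chain_tree (l ++ v :: u :: r).
Proof.
move=> sP ru; have /and3P[Us /forallP clq qs] := sP.
have := Us; rewrite cat_uniq /= !negb_or => /and3P[_ /and3P[ul vl _]].
case/and3P=> /andP[uv ur] vr _.
apply/ffunP => w; rewrite !ffunE.
have [->|wv] := eqVneq w v.
  by rewrite !chain_parent_cat (negPf ul) (negPf vl) !chain_parent_head.
have [->|wu] := eqVneq w u.
  by rewrite chain_parent_cat (negPf ul) chain_parent_cons // chain_parent_head.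
rewrite [in RHS]chain_parent_cat ![chain_parent _ (_ ++ _) w]chain_parent_cat.
have [wl|wl] := boolP (w \in l).
  by case: (_ =P Some v) => [/chain_parent_mem|//]; rewrite (negPf vl).
rewrite !chain_parent_cons //.
case: r => [|y r] in sP ru Us clq qs ur vr *.
  rewrite /chain_parent /= eqxx /=; case: existsP => // -[].
  rewrite /= in ru; exists w; apply/andP; split; first by rewrite inE connect0.
  by rewrite spk_adjE eq_sym wu ru.
have [->|wy] := eqVneq w y; last first.
  rewrite !chain_parent_cons //; case: (_ =P Some v) => [/chain_parent_mem|//].
  move: vr; rewrite inE negb_or => /andP[/negPf vy /negPf->].
  by rewrite /eq_op /= eq_sym vy.
rewrite !chain_parent_head eqxx /=; case: existsP => // -[].
exists (last y r); apply/andP; split.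
  have := @subtree_last_chain (l ++ [:: u; v]) y r; rewrite -catA; exact.
rewrite spk_adjE; apply/andP; split.
  by apply: contraNneq ur => ->; exact: mem_last.
by move: qs; rewrite /ends_in_clique map_cat last_cat /= last_map /= => ->; rewrite orbT.
Qed.

(** Here [v] is the last clique vertex and its children are independent leaves,
    none adjacent to the independent vertex [u]: they stay with [v], and [u]
    becomes one more leaf. *)
Lemma rotate_shorten l u v :
  spanning_chain (l ++ [:: u; v]) -> ~~ in_clique u ->
  rotate u v (chain_tree (l ++ [:: u; v])) = chain_tree (l ++ [:: v]).
Proof.
move=> sP qu; have /and3P[Us /forallP clq qs] := sP.
have := Us; rewrite cat_uniq /= !negb_or => /and3P[_ /and3P[ul vl _]].
case/andP=> /andP[uv _] _.
apply/ffunP => w; rewrite !ffunE.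
have [->|wv] := eqVneq w v.
  by rewrite !chain_parent_cat (negPf ul) (negPf vl) !chain_parent_head.
have [->|wu] := eqVneq w u.
  by rewrite chain_parent_cat (negPf ul) chain_parent_cons.
rewrite [in RHS]chain_parent_cat ![chain_parent _ (_ ++ _) w]chain_parent_cat.
have [wl|wl] := boolP (w \in l).
  by case: (_ =P Some v) => [/chain_parent_mem|//]; rewrite (negPf vl).
rewrite !chain_parent_cons // {1 2}/chain_parent /= eqxx /=.
have ws : w \notin l ++ [:: u; v] by rewrite mem_cat !inE !negb_or wl wu.
rewrite subtree_leaf //; case: existsP => // -[x /andP[]].
rewrite inE => /eqP->; rewrite spk_adjE (negPf qu) /= => /andP[_ qw].
by case: w qw ws {wl wu wv} => // i _; rewrite clq.
Qed.

(** The reverse of [rotate_shorten]: the leaf [v] moves up between [u] and its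
    parent, and the other leaves stay with [u]. *)
Lemma rotate_lengthen l u v :
  spanning_chain (l ++ [:: u]) -> v \notin l ++ [:: u] ->
  rotate u v (chain_tree (l ++ [:: u])) = chain_tree (l ++ [:: v; u]).
Proof.
move=> sP; rewrite mem_cat inE negb_or => /andP[vl vu].
have /and3P[+ _ _] := sP; rewrite cat_uniq /= orbF => /and3P[_ ul _].
apply/ffunP => w; rewrite !ffunE.
have [->|wv] := eqVneq w v.
  by rewrite !chain_parent_cat (negPf ul) (negPf vl) !chain_parent_head.
have [->|wu] := eqVneq w u.
  by rewrite chain_parent_cat (negPf ul) chain_parent_cons 1?eq_sym // chain_parent_head.
rewrite [in RHS]chain_parent_cat ![chain_parent _ (_ ++ _) w]chain_parent_cat.
have [wl|wl] := boolP (w \in l).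
  by case: (_ =P Some v) => [/chain_parent_mem|//]; rewrite (negPf vl).
rewrite !chain_parent_cons //.
by rewrite {1}/chain_parent /= /eq_op /= eq_sym (negPf vu).
Qed.

Lemma spanning_chain_swap l u v r :
  spanning_chain (l ++ u :: v :: r) -> (r != [::]) || in_clique u ->
  spanning_chain (l ++ v :: u :: r).
Proof.
have P : perm_eq (l ++ v :: u :: r) (l ++ u :: v :: r).
  by rewrite perm_cat2l (perm_catCA [:: v] [:: u] r).
case/and3P=> Us /forallP clq qs ru; apply/and3P; split.
- by rewrite (perm_uniq P).
- by apply/forallP => i; rewrite (perm_mem P).
by move: qs ru; rewrite /ends_in_clique !map_cat !last_cat /=; case: r {P Us clq}.
Qed.

(** The second alternative singles out the rotations of two clique vertices, the
    only ones that matter for the cut below. Every other rotation moves an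
    independent vertex, which the order of the clique vertices does not see. *)
Lemma rotate_chain_tree s u v : spanning_chain s -> chain_parent None s v = Some u ->
  exists s', [/\ spanning_chain s', rotate u v (chain_tree s) = chain_tree s' &
   clique_order s' = clique_order s \/ exists l i j r,
    s = l ++ inl i :: inl j :: r /\ s' = l ++ inl j :: inl i :: r].
Proof.
move=> sP Tv; have /and3P[Us /forallP clq qs] := sP.
case: (chain_parent_split Us Tv) => [[l [r E]]|[l E vs]]; subst s.
  have [ru|] := boolP ((r != [::]) || in_clique u).
    exists (l ++ v :: u :: r); split.
    - exact: spanning_chain_swap.
    - exact: rotate_swap.
    have [/andP[]|quv] := boolP (in_clique u && in_clique v).
      case: u v {Tv Us clq qs sP ru} => // i [] // j _ _.
      by right; exists l, i, j, r.
    left; rewrite /clique_order !pmap_cat /=.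
    by case: u v quv {Tv Us clq qs sP ru} => [i|i] [j|j].
  rewrite negb_or negbK => /andP[/eqP E qu]; subst r.
  exists (l ++ [:: v]); split.
  - apply/and3P; split.
    + by apply: subseq_uniq Us; rewrite cat_subseq // (suffix_subseq [:: u]).
    + apply/forallP => i; have := clq i; rewrite !mem_cat !inE.
      by case: (_ =P u) => [E|//]; rewrite -E in qu.
    + by move: qs; rewrite /ends_in_clique !map_cat !last_cat.
  - exact: rotate_shorten.
  by left; rewrite /clique_order !pmap_cat /=; case: (u) qu.
exists (l ++ [:: v; u]); split.
- apply/and3P; split.
  + have P : perm_eq (l ++ [:: v; u]) (v :: l ++ [:: u]).
      by rewrite (perm_catCA l [:: v] [:: u]).
    by rewrite (perm_uniq P) cons_uniq vs.
  + apply/forallP => i; have := clq i; rewrite !mem_cat !inE.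
    by case/orP=> ->; rewrite ?orbT.
  + by move: qs; rewrite /ends_in_clique !map_cat !last_cat.
- exact: rotate_lengthen.
left; rewrite /clique_order !pmap_cat /=.
by case: (v) vs => // i; rewrite clq.
Qed.
End SearchTreesOfSplitGraph.

(** * Degrees in the rotation graph *)

Section RotationGraph.
Variables p q : nat.
Local Notation G := (SPK p.+1 q).
Local Notation RG := (rotation_graph G).
Implicit Types (s l r : seq G) (T : search_tree G) (a i j : 'I_p.+1).

Definition chain_of T : seq G := xchoose (elimT (is_search_treeP (val T)) (valP T)).

Lemma chain_of_spanning T : spanning_chain (chain_of T).
Proof. by case/andP: (xchooseP (elimT (is_search_treeP (val T)) (valP T))). Qed.

Lemma chain_ofK T : val T = chain_tree (chain_of T).
Proof. by case/andP: (xchooseP (elimT (is_search_treeP (val T)) (valP T))) => _ /eqP. Qed.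

Lemma chain_of_eq T s : spanning_chain s -> val T = chain_tree s -> chain_of T = s.
Proof.
move=> sP Ts; apply: chain_tree_inj => //; first exact: chain_of_spanning.
by rewrite -chain_ofK.
Qed.

Lemma chain_of_inj : injective chain_of.
Proof. by move=> T T' E; apply: val_inj; rewrite !chain_ofK E. Qed.

Lemma is_search_tree_of_chain s : spanning_chain s -> is_search_tree (chain_tree s).
Proof. by move=> sP; apply/is_search_treeP; exists s; rewrite sP eqxx. Qed.

Lemma chain_of_onto s : spanning_chain s -> exists T, chain_of T = s.
Proof.
move=> sP; exists (Sub (chain_tree s) (is_search_tree_of_chain sP)).
by apply: chain_of_eq; rewrite ?SubK.
Qed.

Lemma chain_of_parent T v : val T v = chain_parent None (chain_of T) v.
Proof. by rewrite chain_ofK ffunE. Qed.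

(** The exchange of two consecutive vertices is its own inverse, so the direction
    of the rotation does not matter. *)
Lemma rotation_adj_chain T T' : rotation_adj T T' ->
  clique_order (chain_of T') = clique_order (chain_of T) \/ exists l i j r,
    chain_of T = l ++ inl i :: inl j :: r /\ chain_of T' = l ++ inl j :: inl i :: r.
Proof.
have dir T1 T2 : rotates_to T1 T2 ->
    clique_order (chain_of T2) = clique_order (chain_of T1) \/ exists l i j r,
    chain_of T1 = l ++ inl i :: inl j :: r /\ chain_of T2 = l ++ inl j :: inl i :: r.
  case/existsP=> u /existsP[v /andP[/eqP Tv /eqP E]].
  rewrite chain_of_parent in Tv.
  have [s [sP Es rel]] := rotate_chain_tree (chain_of_spanning T1) Tv.
  by rewrite (chain_of_eq sP) // E chain_ofK.
case/orP=> /dir // [->|[l [i [j [r []]]]]]; [by left | right].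
by exists l, j, i, r.
Qed.

Lemma parent_index T u v : val T v = Some u -> index u (chain_of T) < index v (chain_of T).
Proof.
have /and3P[U _ _] := chain_of_spanning T.
by rewrite chain_of_parent => /(chain_parent_index U)->.
Qed.

(** In the rotated tree [v] is the parent of [u] and the old parent of [u] is the
    parent of [v]. If two different rotations gave the same tree, these relations
    would force a cycle of length one or three among the parents in the old tree,
    which the depth excludes. *)
Lemma rotate_inj T u v u' v' :
  val T v = Some u -> val T v' = Some u' ->
  rotate u v (val T) = rotate u' v' (val T) -> v = v'.
Proof.
pose d w := index w (chain_of T).
have lt_d w x : val T x = Some w -> d w < d x := @parent_index T w x.
move=> Tv Tv' /ffunP E; have [//|vv'] := eqVneq v v'.
have neq w x : d w < d x -> (w == x) = false.
  by move=> lt_wx; apply/eqP => wx; rewrite wx ltnn in lt_wx.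
have duv := lt_d _ _ Tv; have duv' := lt_d _ _ Tv'.
have [Eu|v'u] := eqVneq v' u.
  have := E u; rewrite !ffunE neq // eqxx -{1}Eu eqxx => /esym/lt_d dvu.
  by have := ltn_trans (ltn_trans duv dvu) duv'; rewrite Eu ltnn.
have := E v'; rewrite !ffunE [v' == v]eq_sym (negPf vv') (negPf v'u) eqxx.
case: ifP => [/andP[/eqP Tv'v _] _|_ /esym].
  rewrite Tv'v in Tv'; case: Tv' => Ev; rewrite -{}Ev {u'} in duv' E *.
  have := E v; rewrite !ffunE !eqxx (negPf vv') => /lt_d dv'u.
  by have := ltn_trans (ltn_trans duv duv') dv'u; rewrite ltnn.
by rewrite Tv' => /lt_d; rewrite ltnn.
Qed.

(** Every vertex except the root gives a rotation, with its parent. *)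
Lemma rotation_degree (T : RG) : p + q <= #|[set T' : RG | adj T T']|.
Proof.
have sP := chain_of_spanning T; pose D := [set v | val T v != None].
have le_D : p + q <= #|D|.
  have : #|~: D| <= 1.
    apply/card_le1_eqP.
    have root v : v \in ~: D -> index v (chain_of T) = 0.
      rewrite !inE negbK chain_of_parent /chain_parent => /eqP.
      case E: (index _ _) => [|i] //=; rewrite (nth_map v) // -E.
      exact: index_size.
    have mem v : v \in ~: D -> v \in chain_of T.
      by move/root; rewrite -index_mem => ->; case: (chain_of T) sP => // /and3P[].
    by move=> v w vD wD; rewrite -(nth_index w (mem v vD)) root // -(root w wD) nth_index ?mem.
  have := cardsC D; rewrite card_sum !card_ord; lia.
pose f v : RG := if val T v is Some u then insubd T (rotate u v (val T)) else T.
have f_rot u v : val T v = Some u -> val (f v) = rotate u v (val T).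
  rewrite /f => Tv; rewrite Tv insubdK //.
  rewrite chain_of_parent in Tv; have [s [sP' E _]] := rotate_chain_tree sP Tv.
  by rewrite chain_ofK E; apply: is_search_tree_of_chain.
apply: leq_trans le_D _; rewrite -(card_in_imset (f := f)).
  apply/subset_leq_card/subsetP=> _ /imsetP[v + ->]; rewrite !inE.
  case Tv: (val T v) => [u|] // _; apply/orP; left.
  by apply/existsP; exists u; apply/existsP; exists v; rewrite Tv (f_rot u) ?eqxx.
move=> v v'; rewrite !inE; case Tv: (val T v) => [u|] //; case Tv': (val T v') => [u'|] //.
move=> _ _ /(congr1 val); rewrite (f_rot u) // (f_rot u') //.
exact: rotate_inj.
Qed.

(** * A sparse cut of the rotation graph *)

Lemma clique_orderP T : perm_eq (clique_order (chain_of T)) (enum 'I_p.+1).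
Proof.
have /and3P[U /forallP clq _] := chain_of_spanning T.
apply: uniq_perm; rewrite ?enum_uniq //.
  apply: (@pmap_uniq _ _ _ (fun i => inl i)) => //.
  by case.
move=> i; rewrite mem_enum mem_pmap; apply/mapP; exists (inl i) => //.
Qed.

Definition clique_rank a T : nat := index a (clique_order (chain_of T)).

Lemma clique_rank_exact T k : k < p.+1 -> #|[set a | clique_rank a T == k]| = 1.
Proof.
have P := clique_orderP T; have U : uniq (clique_order (chain_of T)).
  by rewrite (perm_uniq P) enum_uniq.
have sz : size (clique_order (chain_of T)) = p.+1 by rewrite (perm_size P) size_enum_ord.
move=> kp; apply/eqP/cards1P; exists (nth ord0 (clique_order (chain_of T)) k).
apply/setP=> a; rewrite !inE; apply/eqP/eqP => [<-|->].
  by rewrite nth_index // (perm_mem P) mem_enum.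
by rewrite /clique_rank index_uniq ?sz.
Qed.

(** The automorphism of the split graph induced by a permutation of the clique. *)
Definition relabel (f : {perm 'I_p.+1}) (v : G) : G :=
  match v with inl i => inl (f i) | inr j => inr j end.

Lemma relabel_inj f : injective (relabel f).
Proof. by move=> [i|i] [j|j] //= [] // /perm_inj->. Qed.

Lemma relabel_spanning f s : spanning_chain s -> spanning_chain (map (relabel f) s).
Proof.
case/and3P=> U /forallP clq qs; apply/and3P; split.
- by rewrite (map_inj_uniq (@relabel_inj f)).
- apply/forallP => i; apply/mapP; exists (inl (f^-1 i)%g) => //=.
  by rewrite permKV.
rewrite /ends_in_clique -map_comp; case: s qs {U clq} => // v s.
by rewrite /ends_in_clique /= !last_map /=; case: (last v s).
Qed.

Lemma relabel_order f s : clique_order (map (relabel f) s) = map f (clique_order s).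
Proof. by elim: s => //= -[i|i] s IH /=; rewrite ?IH. Qed.

(** The transposition of [a] and [b] sends trees where [a] has rank [k] to trees
    where [b] has rank [k], injectively. *)
Lemma clique_rank_le a b k :
  #|[set T | clique_rank a T == k]| <= #|[set T | clique_rank b T == k]|.
Proof.
pose f := tperm a b.
pose rT T : search_tree G := insubd T (chain_tree (map (relabel f) (chain_of T))).
have crT T : chain_of (rT T) = map (relabel f) (chain_of T).
  have sP := relabel_spanning f (chain_of_spanning T).
  by apply: chain_of_eq => //; rewrite insubdK //; apply: is_search_tree_of_chain.
have rT_inj : injective rT.
  move=> T T' /(congr1 chain_of); rewrite !crT => /inj_map E.
  by apply: chain_of_inj; apply: E; apply: relabel_inj.
rewrite -(card_imset _ rT_inj); apply/subset_leq_card/subsetP=> _ /imsetP[T + ->].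
rewrite !inE /clique_rank crT relabel_order -(tpermL a b) -/f.
by rewrite index_map //; apply: perm_inj.
Qed.

(** By symmetry the count does not depend on [a], and each tree has exactly one
    clique vertex of rank [k]. *)
Lemma card_clique_rank a k : k < p.+1 ->
  (p.+1 * #|[set T | clique_rank a T == k]|)%N = #|{: search_tree G}|.
Proof.
move=> kp.
have -> : (p.+1 * #|[set T | clique_rank a T == k]|)%N =
          \sum_(b < p.+1) \sum_(T : search_tree G) (clique_rank b T == k).
  transitivity (\sum_(b < p.+1) #|[set T | clique_rank a T == k]|).
    by rewrite sum_nat_const card_ord.
  apply: eq_bigr => b _.
  transitivity #|[set T | clique_rank b T == k]|.
    by apply/eqP; rewrite eqn_leq !clique_rank_le.
  by rewrite -sum1dep_card big_mkcond.
rewrite exchange_big -sum1_card; apply: eq_bigr => T _ /=.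
transitivity #|[set b | clique_rank b T == k]|; last exact: clique_rank_exact.
by rewrite -sum1dep_card [RHS]big_mkcond.
Qed.

Lemma card_clique_rank_lt a m : m <= p.+1 ->
  (p.+1 * #|[set T | clique_rank a T < m]|)%N = (m * #|{: search_tree G}|)%N.
Proof.
elim: m => [|m IH] mp.
  by rewrite (_ : finset _ = set0) ?cards0 ?muln0 //; apply/setP=> T; rewrite !inE.
rewrite -(cardsID [set T | clique_rank a T < m]) mulnDr [in RHS]mulSn addnC.
congr addn.
  rewrite -(card_clique_rank a mp); congr (_ * #|pred_of_set _|)%N.
  by apply/setP=> T; rewrite !inE ltnS -leqNgt -eqn_leq eq_sym.
rewrite -IH 1?ltnW //; congr (_ * #|pred_of_set _|)%N.
by apply/setP=> T; rewrite !inE andbC ltnS andb_idr // => /ltnW.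
Qed.

Definition early a k : {set RG} := [set T | clique_rank a T <= k].

(** Only an exchange of two consecutive clique vertices changes ranks, and it
    changes them by one; so the rank of [a] goes from [k] to [k+1]. *)
Lemma boundary_early a k (T T' : RG) : (T, T') \in boundary (early a k) ->
  clique_rank a T = k /\ exists l j r,
    chain_of T = l ++ inl a :: inl j :: r /\ chain_of T' = l ++ inl j :: inl a :: r.
Proof.
rewrite !inE /= -ltnNge => /and3P[le_k gt_k /rotation_adj_chain].
have P := clique_orderP T.
case=> [E|[l [i [j [r [E E']]]]]].
  by move: gt_k; rewrite /clique_rank E ltnNge le_k.
have U : uniq (clique_order (chain_of T)) by rewrite (perm_uniq P) enum_uniq.
move: U le_k gt_k; rewrite /clique_rank E E' /clique_order !pmap_cat /= -!/(clique_order _).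
rewrite cat_uniq /= inE => /and4P[_ _ /norP[ij _] _].
rewrite !index_cat; case: ifP => [_ le_k|_].
  by rewrite ltnNge le_k.
rewrite /=; have [<-|ia] := eqVneq i a.
  rewrite addn0 [j == i]eq_sym (negPf ij) addn1 ltnS => le_k gt_k.
  by split; [apply/eqP; rewrite eqn_leq le_k | exists l, j, r].
have [_ le_k|_ le_k] := eqVneq j a; last by rewrite ltnNge le_k.
by rewrite addn0 ltnNge (leq_trans _ le_k) // addn1 leqnSn.
Qed.

(** A boundary edge is determined by its endpoint inside the cut, since the other
    chain arises from the exchange of [a] with its successor. The inequality is
    strict because an independent vertex may follow [a]. *)
Lemma boundary_early_lt_rank a k : 0 < q -> val a = k -> k < p ->
  #|boundary (early a k)| < #|[set T | clique_rank a T == k]|.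
Proof.
move=> q_gt0 ak kp; pose B := boundary (early a k).
have fst_inj : {in B &, injective fst}.
  move=> [T T1] [T' T2] /boundary_early[_ [l [j [r [ET ET1]]]]].
  move=> /boundary_early[_ [l' [j' [r' [ET' ET2]]]]] /= E; rewrite -{}E {T'} in ET' *.
  congr pair; apply: chain_of_inj; rewrite ET1 ET2.
  have /and3P[U _ _] := chain_of_spanning T.
  rewrite ET in U ET'; have [-> [-> ->]] := uniq_cat_cons_inj U ET'.
  by [].
rewrite -(card_in_imset fst_inj); apply/proper_card/properP; split.
  apply/subsetP=> _ /imsetP[[T T'] /boundary_early[Tk _] ->]; rewrite inE /=.
  exact/eqP.
(* The tree that is missed: the clique in increasing order, with an independent
   vertex inserted right after [a]. *)
pose c := enum 'I_p.+1.
have ec : c = take k c ++ a :: drop k.+1 c.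
  rewrite -[LHS](cat_take_drop k) (drop_nth a) ?size_enum_ord ?ltnS 1?ltnW //.
  by rewrite /c -{2}ak nth_ord_enum.
pose w : G := inr (Ordinal q_gt0).
pose s : seq G := map inl (take k c) ++ inl a :: w :: map inl (drop k.+1 c).
have P : perm_eq s (w :: map inl c).
  by rewrite ec map_cat /= /s -[_ :: w :: _]/([:: inl a] ++ [:: w] ++ _) catA
     (perm_catCA _ [:: w]) /= -catA.
have sP : spanning_chain s.
  apply/and3P; split.
  - rewrite (perm_uniq P) /= map_inj_uniq ?enum_uniq ?andbT; last by move=> ? ? [].
    by apply/mapP=> -[].
  - by apply/forallP=> i; rewrite (perm_mem P) inE map_f ?orbT ?mem_enum.
  rewrite /ends_in_clique map_cat last_cat /= !last_map.
  have : size (drop k.+1 c) != 0 by rewrite size_drop size_enum_ord subSS -lt0n subn_gt0.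
  by case: (drop _ _) => //= i t _; rewrite last_map.
have [T ET] := chain_of_onto sP.
have inlK t : clique_order (map inl t) = t by elim: t => //= i t ->.
exists T.
  rewrite inE /clique_rank ET /s /clique_order pmap_cat /= -!/(clique_order _).
  by rewrite !inlK -ec index_enum_ord ak.
apply/imsetP=> -[[T' T''] /boundary_early[_ [l [j [r [ET' _]]]]] /= E].
have /and3P[U _ _] := sP; rewrite -E ET /s in ET'.
by have [] := uniq_cat_cons_inj U ET'.
Qed.

Lemma exists_sparse_cut : 0 < q -> 0 < p -> exists S : {set RG},
  [/\ S != set0, #|S|.*2 <= #|RG| & #|boundary S| * p < 2 * #|S|].
Proof.
move=> q_gt0 p_gt0.
(* [k.+1] is half of [p.+1], rounded down. *)
pose k := p.-1./2; pose a : 'I_p.+1 := inord k.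
have kp : k < p by rewrite /k; lia.
have ak : val a = k by rewrite /= inordK //; lia.
have bd := boundary_early_lt_rank q_gt0 ak kp.
have := @card_clique_rank a k; rewrite ltnS (ltnW kp) => /(_ isT).
have := @card_clique_rank_lt a k.+1; rewrite ltnS (ltnW kp) => /(_ isT).
set c := #|[set T | clique_rank a T == k]| in bd *.
set N := #|{: search_tree G}| => cS cN.
have {}cS : #|early a k| = k.+1 * c.
  by apply/eqP; rewrite -(eqn_pmul2l (ltn0Sn p)) cS -cN mulnCA.
exists (early a k); split.
- by rewrite -card_gt0 cS muln_gt0 (leq_ltn_trans _ bd).
- rewrite cS -cN -mul2n mulnA leq_pmul2r ?(leq_ltn_trans _ bd) // /k; lia.
rewrite cS; apply: (@leq_trans (c * p)); first by rewrite ltn_pmul2r.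
rewrite mulnC mulnA leq_pmul2r ?(leq_ltn_trans _ bd) // /k; lia.
Qed.

End RotationGraph.

Local Open Scope ring_scope.

(** * The second eigenvalue of a real symmetric matrix *)

Lemma count_flatten_nseq (T : eqType) (m : T -> nat) (s : seq T) x : uniq s ->
  count_mem x (flatten [seq nseq (m y) y | y <- s]) = (if x \in s then m x else 0)%N.
Proof.
elim: s => //= y s IH /andP[ys Us]; rewrite count_cat IH // count_nseq inE /=.
have [<-|_] := eqVneq y x; last by rewrite mul0n.
by rewrite (negPf ys) mul1n addn0.
Qed.

Lemma char_poly_similar (R : comNzRingType) n (A P Q : 'M[R]_n) :
  P *m Q = 1%:M -> char_poly (P *m A *m Q) = char_poly A.
Proof.
move=> PQ; rewrite /char_poly.
have pPQ : map_mx polyC P *m map_mx polyC Q = 1%:M by rewrite -map_mxM PQ map_mx1.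
have -> : char_poly_mx (P *m A *m Q) =
    map_mx polyC P *m char_poly_mx A *m map_mx polyC Q.
  by rewrite /char_poly_mx mulmxBr mulmxBl !map_mxM mul_mx_scalar -scalemxAl pPQ scalemx1.
by rewrite !det_mulmx mulrAC -det_mulmx pPQ det1 mul1r.
Qed.

Section Spectrum.
Variable R : rcfType.

Lemma eigenvalues_perm n (A : 'M[R]_n) s :
  char_poly A = \prod_(x <- s) ('X - x%:P) -> perm_eq (eigenvalues A) s.
Proof.
move=> E; apply/allP => x _ /=; apply/eqP; rewrite /eigenvalues.
have nz : char_poly A != 0 by rewrite monic_neq0 ?char_poly_monic.
rewrite count_flatten_nseq ?rev_uniq ?uniq_roots // mem_rev.
have <- : mup x (char_poly A) = count_mem x s by rewrite E mu_prod_XsubC.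
case: ifP => // /negbT; rewrite -(roots_on_rootsR nz) in_itv /= => /mupNroot.
by [].
Qed.

Lemma eigenvalues_sorted n (A : 'M[R]_n) : sorted >=%R (eigenvalues A).
Proof.
rewrite /eigenvalues; have : sorted >%R (rev (rootsR (char_poly A))).
  by rewrite rev_sorted sorted_roots.
rewrite sorted_pairwise; last by move=> x y z /= yx xz; apply: lt_trans xz yx.
rewrite sorted_pairwise; last by move=> x y z /= yx xz; apply: le_trans xz yx.
elim: (rev _) => //= x s IH /andP[/allP xs /IH{}IH].
rewrite pairwise_cat IH andbT; apply/andP; split.
  apply/allrelP => y z; rewrite mem_nseq => /andP[_ /eqP->].
  by case/flatten_mapP=> t /xs /ltW tx; rewrite mem_nseq => /andP[_ /eqP->].
elim: (mup _ _) => //= k ->; rewrite andbT; apply/allP => y.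
by rewrite mem_nseq => /andP[_ /eqP->]; apply: lexx.
Qed.

Lemma sorted_nth1_gt (s : seq R) c : sorted >=%R s -> (1 < count (> c) s)%N -> c < nth 0 s 1.
Proof.
case: s => [|x [|y s]] //=; first by case: (c < x).
case/andP=> _ sy; rewrite ltNge; case: (leP y c) => //= yc.
rewrite (_ : count _ s = 0)%N; first by case: (x <= c).
apply/eqP; rewrite -leqn0 leqNgt -has_count; apply/hasPn => z zs.
rewrite -leNgt (le_trans _ yc) //.
have trans_ge : transitive (>=%R : rel R) by move=> a b d /= ab bd; apply: le_trans bd ab.
by have /allP/(_ z zs) := order_path_min trans_ge sy.
Qed.

End Spectrum.

(** With [j] the imaginary unit and [M], [x], [y] real, this is the value of the
    Hermitian form of [M] at [x + j y]: the cross terms cancel by symmetry. *)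
Lemma sum_of_squares_form (K : comNzRingType) (j : K) n (M : 'M[K]_n) (x y : 'rV_n) :
  j * j = -1 -> M^T = M ->
  (x + j *: y) *m M *m (x - j *: y)^T = x *m M *m x^T + y *m M *m y^T.
Proof.
move=> jj symM.
have cross : y *m M *m x^T = x *m M *m y^T.
  have <- : (y *m M *m x^T)^T = x *m M *m y^T by rewrite !trmx_mul trmxK symM mulmxA.
  by apply/matrixP=> i k; rewrite [RHS]mxE !ord1.
rewrite linearB linearZ /= !mulmxDl !mulmxBr -!scalemxAr -!scalemxAl cross scalerA jj.
by rewrite scaleN1r opprK addrA subrK.
Qed.

Lemma diag_form (K : numClosedFieldType) n (e x : 'rV[K]_n) :
  (x *m diag_mx e *m map_mx Num.conj x^T) 0 0 = \sum_i e 0 i * `|x 0 i| ^+ 2.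
Proof.
rewrite mxE; apply: eq_bigr => i _; rewrite mul_mx_diag !mxE normCK.
by rewrite mulrAC mulrC.
Qed.

Section SecondEigenvalue.
Variable R : rcfType.
Local Notation C := R[i].
Local Notation toC := (real_complex R).
Local Notation cmx := (map_mx toC).
Local Notation adjmx M := (map_mx Num.conj M^T).

Lemma conj_toC (x : R) : Num.conj (toC x) = toC x.
Proof. by apply/CrealP; rewrite complex_real. Qed.

Lemma symmetric_spectral n (A : 'M[R]_n) : A^T = A ->
  exists (d : 'I_n -> R) (P : 'M[C]_n),
  [/\ adjmx P *m P = 1%:M, cmx A = adjmx P *m diag_mx (\row_i toC (d i)) *m P &
    char_poly A = \prod_i ('X - (d i)%:P)].
Proof.
move=> symA.
have hA : cmx A \is hermsymmx.
  apply/is_hermitianmxP; rewrite expr0 scale1r map_trmx symA -map_mx_comp.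
  by apply/matrixP=> i j; rewrite !mxE /= conj_toC.
have /hermitian_normalmx/orthomx_spectralP := hA.
have := hermitian_spectral_diag_real hA.
have := spectral_unitarymx (cmx A).
move: (spectralmx _) (spectral_diag _) => P D uP rD EA.
have PP : adjmx P *m P = 1%:M by rewrite -invmx_unitary // mulVmx // unitarymx_unit.
exists (fun i => complex.Re (D 0 i)), P.
have DE : \row_i toC (complex.Re (D 0 i)) = D.
  apply/rowP=> i; rewrite mxE.
  exact/RRe_real/mxOverP.
rewrite DE; split=> //; first by rewrite -invmx_unitary.
apply: (map_poly_inj toC); rewrite map_char_poly EA invmx_unitary //.
rewrite char_poly_similar // char_poly_trig ?diag_mx_is_trig // rmorph_prod.
by apply: eq_bigr => i _; rewrite /= map_polyXsubC -DE !mxE eqxx.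
Qed.

(** The min-max principle for planes. If at most one eigenvalue exceeded [c], one
    linear condition (orthogonality to its eigenvector) would cut out of the plane
    spanned by the rows of [U] a nonzero complex vector where the form of [A - c]
    is at most 0. By [sum_of_squares_form] this value is the sum of the values at
    the real and the imaginary part of the vector, one of them positive by
    assumption. *)
Lemma second_eigenvalue_gt n (A : 'M[R]_n) (c : R) (U : 'M[R]_(2, n)) :
  A^T = A ->
  (forall f : 'rV_2, f != 0 ->
     c * (f *m U *m (f *m U)^T) 0 0 < (f *m U *m A *m (f *m U)^T) 0 0) ->
  c < nth 0 (eigenvalues A) 1.
Proof.
move=> symA posA; apply: sorted_nth1_gt; first exact: eigenvalues_sorted.
have [d [P [PP EA charA]]] := symmetric_spectral symA.
rewrite -(big_map d xpredT (fun x => 'X - x%:P)) in charA.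
rewrite (seq.permP (eigenvalues_perm charA)) ltnNge count_map.
apply/negP => few.
(* The linear condition is the equation [f *m h = 0]. *)
have [h small] : exists h : 'cV[C]_2, forall f : 'rV[C]_2, f *m h = 0 ->
    forall i, c < d i -> (f *m cmx U *m adjmx P) 0 i = 0.
  rewrite -sum1_count sum1dep_card in few; move/card_le1_eqP: few => uniq_gt.
  have [/existsP[i0 di0]|] := boolP [exists i, c < d i].
    exists (col i0 (cmx U *m adjmx P)) => f fh i di.
    have -> : i = i0 by apply: uniq_gt; rewrite inE.
    by move: fh; rewrite colE !mulmxA -colE => /colP/(_ 0); rewrite mxE [RHS]mxE.
  by rewrite negb_exists => /forallP no; exists 0 => f _ i di; have := no i; rewrite di.
have [f f0 fh] : exists2 f : 'rV[C]_2, f != 0 & f *m h = 0.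
  have : kermx h != 0.
    rewrite -mxrank_eq0 mxrank_ker -lt0n subn_gt0.
    by apply: leq_ltn_trans (rank_leq_col _) _.
  rewrite -nz_row_eq0 => nz; exists (nz_row (kermx h)) => //.
  exact/sub_kermxP/nz_row_sub.
pose M := U *m (A - c%:M) *m U^T.
have symM : M^T = M.
  by rewrite /M !trmx_mul trmxK raddfB /= symA tr_scalar_mx mulmxA.
have posM (g : 'rV_2) : g != 0 -> 0 < (g *m M *m g^T) 0 0.
  move/posA; rewrite -subr_gt0; congr (0 < _).
  rewrite /M !mulmxA -[in RHS]mulmxA -trmx_mul mulmxBr mulmxBl mul_mx_scalar -scalemxAl.
  by rewrite [RHS]mxE [X in _ = _ + X]mxE [X in _ = _ - X]mxE.
have neg : (f *m cmx M *m adjmx f) 0 0 <= 0.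
  pose X := f *m cmx U; pose g := X *m adjmx P.
  have adjX : adjmx X = (cmx U)^T *m adjmx f.
    rewrite trmx_mul map_mxM; congr (_ *m _).
    by apply/matrixP=> i j; rewrite !mxE; apply: conj_toC.
  have adjg : adjmx g = P *m adjmx X by rewrite trmx_mul map_mxM trmxCK.
  have EAc : cmx (A - c%:M) = adjmx P *m diag_mx (\row_i toC (d i - c)) *m P.
    have -> : diag_mx (\row_i toC (d i - c)) = diag_mx (\row_i toC (d i)) - (toC c)%:M.
      apply/matrixP=> i j; rewrite !mxE rmorphB.
      by case: eqP => _; rewrite ?mulr1n ?mulr0n ?subr0.
    rewrite map_mxB map_scalar_mx EA mulmxBr mulmxBl; congr (_ - _).
    by rewrite mul_mx_scalar -scalemxAl PP scalemx1.
  have -> : f *m cmx M *m adjmx f = g *m diag_mx (\row_i toC (d i - c)) *m adjmx g.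
    by rewrite adjg adjX /g /X /M !map_mxM map_trmx EAc !mulmxA.
  rewrite diag_form.
  apply: sumr_le0 => i _; have [/(small f fh)|] := ltP c (d i).
    by rewrite -/X -/g => ->; rewrite normr0 expr0n mulr0.
  by move=> dc; rewrite mxE; apply: mulr_le0_ge0; [rewrite lecR subr_le0 | rewrite exprn_ge0].
clearbody M.
pose f1 := map_mx (@complex.Re R) f; pose f2 := map_mx (@complex.Im R) f.
have Ef : f = cmx f1 + 'i%C *: cmx f2.
  by apply/rowP=> i; rewrite !mxE -complexE.
have Efc : adjmx f = (cmx f1 - 'i%C *: cmx f2)^T.
  apply/colP=> i; rewrite !mxE.
  by case: (f 0 i) => x y; apply/eqP; rewrite eq_complex /=; apply/andP; split; apply/eqP; ring.
clearbody f1 f2.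
have form_ge0 (g : 'rV_2) : 0 <= (g *m M *m g^T) 0 0.
  by have [->|/posM/ltW//] := eqVneq g 0; rewrite !mul0mx mxE.
have : (f *m cmx M *m adjmx f) 0 0 = toC ((f1 *m M *m f1^T) 0 0 + (f2 *m M *m f2^T) 0 0).
  rewrite Efc {1}Ef sum_of_squares_form ?map_trmx ?symM -?expr2 ?sqr_i //.
  rewrite -!map_mxM -map_mxD [LHS]mxE; congr (toC _).
  by rewrite mxE.
move=> E; rewrite E lecR in neg.
have [f10|/posM] := eqVneq f1 0; have [f20|/posM] := eqVneq f2 0.
- by move: f0; rewrite Ef f10 f20 !map_mx0 scaler0 addr0 eqxx.
- by rewrite ltNge (le_trans _ neg) // lerDr.
- by rewrite ltNge (le_trans _ neg) // lerDl.
- by rewrite ltNge (le_trans _ neg) // lerDr.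
Qed.
End SecondEigenvalue.

(** * Sparse cuts and the second eigenvalue *)

(** The easy half of the Cheeger inequality, with a lower bound on the degrees in
    place of regularity. For the function that is [a] on [S] and [b] outside, the
    adjacency form is the degree-weighted sum of squares minus [(a - b)^2] times the
    boundary, and [(a - b)^2] is at most [2 (a^2 + b^2)]; since [S] is not larger
    than its complement, [a^2 + b^2] is at most the sum of squares divided by the
    size of [S]. *)
Lemma lambda2_gt_cut (R : rcfType) (H : sgraph) (S : {set H}) (d : nat) (h : R) :
  (forall x : H, (d <= #|[set y : H | adj x y]|)%N) -> (#|S|.*2 <= #|H|)%N ->
  #|boundary S|%:R < h * #|S|%:R -> d%:R - 2 * h < lambda2 R H.
Proof.
move=> deg half bd.
pose U : 'M[R]_(2, #|H|) := \matrix_(k, i) ((enum_val i \in S) == (k == 0))%:R.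
apply: (@second_eigenvalue_gt _ _ _ _ U).
  by apply/matrixP=> i j; rewrite !mxE adj_sym.
move=> f f0; set a := f 0 0; set b := f 0 1.
pose phi (x : H) := if x \in S then a else b.
have fU i : (f *m U) 0 i = phi (enum_val i).
  rewrite mxE !big_ord_recl big_ord0 /phi !mxE /= addr0.
  have -> : lift ord0 ord0 = 1 :> 'I_2 by apply/val_inj.
  by case: ifP => _; rewrite ?mulr1 ?mulr0 ?addr0 ?add0r.
have ab : 0 < a ^+ 2 + b ^+ 2.
  rewrite lt_neqAle addr_ge0 ?sqr_ge0 // andbT eq_sym paddr_eq0 ?sqr_ge0 //.
  rewrite !sqrf_eq0; apply: contraNN f0 => /andP[/eqP a0 /eqP b0].
  apply/eqP/rowP=> i; rewrite mxE; case: i => -[|[|//]] lti.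
    by rewrite -[RHS]a0; congr (f 0 _); apply/val_inj.
  by rewrite -[RHS]b0; congr (f 0 _); apply/val_inj.
have norm : (f *m U *m (f *m U)^T) 0 0 = \sum_(x : H) phi x ^+ 2.
  rewrite mxE (big_enum_val (A := H) (fun x => phi x ^+ 2)) /=.
  by apply: eq_bigr => i _; rewrite [X in _ * X]mxE fU expr2.
have form : (f *m U *m adj_matrix R H *m (f *m U)^T) 0 0 =
    \sum_(x : H) \sum_(y : H) (adj x y)%:R * (phi x * phi y).
  pose F x y := (adj x y)%:R * (phi x * phi y).
  rewrite mxE exchange_big (big_enum_val (A := H) (fun y => \sum_(x : H) F x y)) /=.
  apply: eq_bigr => j _; rewrite [X in _ * X]mxE fU mxE.
  rewrite (big_enum_val (A := H) (F^~ (enum_val j))) /= mulr_suml.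
  by apply: eq_bigr => i _; rewrite fU /F !mxE; ring.
rewrite {}norm {}form.
have cut : \sum_(x : H) \sum_(y : H) [&& x \in S, y \notin S & adj x y]%:R
    = #|boundary S|%:R :> R.
  rewrite pair_big /= -sum1_card natr_sum [RHS]big_mkcond /=.
  by apply: eq_bigr => -[x y] _; rewrite inE /=; case: (_ && _).
have degs : d%:R * \sum_x phi x ^+ 2 <= \sum_(x : H) \sum_(y : H) (adj x y)%:R * phi x ^+ 2.
  rewrite mulr_sumr ler_sum // => x _; rewrite -mulr_suml ler_wpM2r ?sqr_ge0 //.
  apply: le_trans (_ : #|[set y | adj x y]|%:R <= _); first by rewrite ler_nat.
  rewrite -sum1dep_card natr_sum big_mkcond /=.
  by rewrite ler_sum // => y _; case: ifP.
have split_form : \sum_(x : H) \sum_(y : H) (adj x y)%:R * (phi x * phi y) =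
   \sum_(x : H) \sum_(y : H) (adj x y)%:R * phi x ^+ 2 - #|boundary S|%:R * (a - b) ^+ 2.
  pose sq := (a - b) ^+ 2.
  have W : \sum_(x : H) \sum_(y : H) [&& x \in S, y \notin S & adj x y]%:R * sq
      = #|boundary S|%:R * sq.
    by rewrite -cut mulr_suml; apply: eq_bigr => x _; rewrite mulr_suml.
  have W' : \sum_(x : H) \sum_(y : H) [&& y \in S, x \notin S & adj x y]%:R * sq
      = #|boundary S|%:R * sq.
    rewrite -W exchange_big; apply: eq_bigr => x _; apply: eq_bigr => y _.
    by rewrite adj_sym.
  have Y' : \sum_(x : H) \sum_(y : H) (adj x y)%:R * phi y ^+ 2 =
            \sum_(x : H) \sum_(y : H) (adj x y)%:R * phi x ^+ 2.
    rewrite exchange_big; apply: eq_bigr => x _; apply: eq_bigr => y _.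
    by rewrite adj_sym.
  suff : \sum_(x : H) \sum_(y : H) (adj x y)%:R * (phi x * phi y) +
      \sum_(x : H) \sum_(y : H) (adj x y)%:R * (phi x * phi y) +
      (#|boundary S|%:R * sq + #|boundary S|%:R * sq) =
      \sum_(x : H) \sum_(y : H) (adj x y)%:R * phi x ^+ 2 +
      \sum_(x : H) \sum_(y : H) (adj x y)%:R * phi x ^+ 2 by rewrite /sq; lra.
  rewrite -{1}W -W' -[X in _ = _ + X]Y' -!big_split; apply: eq_bigr => x _ /=.
  rewrite -!big_split; apply: eq_bigr => y _ /=; rewrite /phi /sq.
  by case: (x \in S); case: (y \in S); case: (adj x y) => /=; ring.
have masses : \sum_x phi x ^+ 2 = #|S|%:R * a ^+ 2 + #|~: S|%:R * b ^+ 2.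
  rewrite (bigID (fun x => x \in S)) /=; congr (_ + _).
    rewrite -sum1_card natr_sum mulr_suml; apply: eq_bigr => x xS.
    by rewrite /phi xS mul1r.
  rewrite -sum1_card natr_sum mulr_suml; apply: eq_big => x; first by rewrite inE.
  by move=> /negPf xS; rewrite /phi xS mul1r.
have SC : #|S|%:R <= #|~: S|%:R :> R by rewrite ler_nat; have := cardsC S; lia.
have SCb : #|S|%:R * b ^+ 2 <= #|~: S|%:R * b ^+ 2 by rewrite ler_wpM2r ?sqr_ge0.
rewrite split_form.
have h0 : 0 <= h.
  rewrite leNgt; apply/negP=> h0; have := lt_le_trans bd (_ : _ <= 0).
  by rewrite nmulr_rle0 // ltNge !ler0n => /(_ isT).
(* What remains is linear in the products of the quantities bounded so far; the
   sign of [(a + b) ^+ 2] bounds [(a - b) ^+ 2] by [2 * (a ^+ 2 + b ^+ 2)]. *)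
have := ler_wpM2l h0 SCb.
have : #|boundary S|%:R * (a ^+ 2 + b ^+ 2) < h * #|S|%:R * (a ^+ 2 + b ^+ 2) by rewrite ltr_pM2r.
have := ler0n R #|boundary S|; have : 0 <= (a + b) ^+ 2 by apply: sqr_ge0.
move=> h1 h2; have := mulr_ge0 h2 h1.
by rewrite masses in degs *; lra.
Qed.

Theorem corollary1 (R : rcfType) (p q : nat) (hp : (1 <= p)%N) (hq : (1 <= q)%N) :
  (edge_expansion R (rotation_graph (SPK p.+1 q)) < (2 / p%:R)%:E)%E /\
  p%:R + q%:R - 4 / p%:R < lambda2 R (rotation_graph (SPK p.+1 q)).
Proof.
have [S [S0 half sparse]] := @exists_sparse_cut p q hq hp.
have p_gt0 : 0 < p%:R :> R by rewrite ltr0n.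
have S_gt0 : 0 < #|S|%:R :> R by rewrite ltr0n card_gt0.
have bd : #|boundary S|%:R < 2 / p%:R * #|S|%:R :> R.
  by rewrite mulrAC ltr_pdivlMr // -!natrM ltr_nat.
split.
  have admissible : (S != set0) && (#|S|.*2 <= #|rotation_graph (SPK p.+1 q)|)%N.
    by rewrite S0.
  apply: (@le_lt_trans _ _ (#|boundary S|%:R / #|S|%:R)%:E).
    exact: (@bigmin_le_cond _ _ _ _ S _ _ admissible).
  by rewrite lte_fin ltr_pdivrMr.
have := lambda2_gt_cut (@rotation_degree p q) half bd.
by rewrite natrD mulrA -natrM.
Qed.
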